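(* (1) For every integer $d \geq 1$ there exists a directive sequence $\sigma = \sigma_0 \circ \sigma_1 \circ \sigma_2 \circ \cdots$ of substitutions $\sigma_n : \mathcal{A}_{n+1}^* \to \mathcal{A}_n^*$, with level alphabets $\mathcal{A}_n$ ($n \geq 0$) all of cardinality $d$, such that the associated subshift $X_\sigma \subseteq \mathcal{A}_0^{\mathbb{Z}}$ is minimal and supports $d$ distinct invariant ergodic probability measures. (2) For every integer $d \geq 1$ there is a finite set $S$, consisting of $4$ substitutions $\mathcal{A}^* \to \mathcal{A}^*$ over one alphabet $\mathcal{A}$ of cardinality $d$, such that in (1) one can take all level alphabets equal to $\mathcal{A}$ and choose all the substitutions $\sigma_0, \sigma_1, \sigma_2, \ldots$ from $S$.
   Context: For a finite alphabet $\mathcal{A}$, $\mathcal{A}^*$ is the free monoid over $\mathcal{A}$, and $\mathcal{A}^{\mathbb{Z}}$ (the full shift, whose elements are the biinfinite words $\ldots x_{-1}x_0x_1\ldots$) carries the product topology of the discrete topology and the shift map $T$, $(Tx)_n = x_{n+1}$. A subshift is a non-empty closed shift-invariant subset $X \subseteq \mathcal{A}^{\mathbb{Z}}$; it is minimal if it is the closure of the shift-orbit of each of its points. Invariant measures are finite Borel measures on $X$ invariant under the shift. A substitution is a monoid homomorphism $\mathcal{A}^* \to \mathcal{A}'^*$ between free monoids over finite alphabets. A directive sequence $\sigma = \sigma_0\circ\sigma_1\circ\cdots$ consists of finite alphabets $\mathcal{A}_n$ ($n \ge 0$), called level alphabets, and substitutions $\sigma_n : \mathcal{A}_{n+1}^*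 \to \mathcal{A}_n^*$. Its language $\mathcal{L}_\sigma \subseteq \mathcal{A}_0^*$ is the set of all factors of the words $\sigma_0\circ\sigma_1\circ\cdots\circ\sigma_n(a)$ with $n \ge 0$ and $a \in \mathcal{A}_{n+1}$. The associated subshift $X_\sigma$ is the set of all $x \in \mathcal{A}_0^{\mathbb{Z}}$ such that for all integers $m \ge n$ the word $x_n \ldots x_m$ belongs to $\mathcal{L}_\sigma$. *)

(* Defs.v *)
From HB Require Import structures.
From mathcomp Require Import all_boot all_order all_algebra.
From mathcomp Require Import all_classical all_reals all_analysis.

Set Implicit Arguments.
Unset Strict Implicit.
Unset Printing Implicit Defensive.

Import Order.TTheory GRing.Theory Num.Theory.

Local Open Scope classical_set_scope.
Local Open Scope ring_scope.

(* The distinguished point carries no mathematical content: it only says that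
   alphabets are non-empty, and is there because [measurableType]s are
   pointed. *)
#[short(type="alphabetType")]
HB.structure Definition Alphabet := {A of Finite A & Pointed A}.

(** Free monoids and substitutions *)

Definition word (A : choiceType) : Type := seq A.

HB.instance Definition _ (A : choiceType) := Choice.copy (word A) (seq A).
HB.instance Definition _ (A : choiceType) :=
  isMonoid.Build (word A) (@catA A) (@cat0s A) (@cats0 A).

Definition substitution (A B : alphabetType) : Type :=
  UMagmaMorphism.type (word A) (word B).

(** The full shift *)

Definition fullshift (A : alphabetType) : Type :=
  {ptws int -> discrete_topology A}.

HB.instance Definition _ (A : alphabetType) := Topological.on (fullshift A).
HB.instance Definition _ (A : alphabetType) := Pointed.on (fullshift A).

Definition shift_map (A : alphabetType) (x : fullshift A) : fullshift A :=
  fun n => x (n + 1).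

Definition shift_pow (A : alphabetType) (k : int) (x : fullshift A) :
  fullshift A := fun n => x (n + k).

Lemma shift_pow0 (A : alphabetType) (x : fullshift A) : shift_pow 0 x = x.
Proof. by apply/funext => n; rewrite /shift_pow addr0. Qed.

Lemma shift_powS (A : alphabetType) (k : int) (x : fullshift A) :
  shift_pow (k + 1) x = shift_map (shift_pow k x).
Proof. by apply/funext => n; rewrite /shift_pow /shift_map addrAC addrA. Qed.

Definition shift_orbit (A : alphabetType) (x : fullshift A) : set (fullshift A) :=
  range (fun k : int => shift_pow k x).

Definition subshift (A : alphabetType) (X : set (fullshift A)) : Prop :=
  [/\ X !=set0, closed X & (@shift_map A) @` X = X].

Definition minimal_subshift (A : alphabetType) (X : set (fullshift A)) : Prop :=
  subshift X /\ forall x, X x -> closure (shift_orbit x) = X.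

(** Directive sequences *)

Section directive_sequence.
Variables (A : nat -> alphabetType) (s : forall n, substitution (A n.+1) (A n)).

Fixpoint comp_upto (n : nat) : word (A n.+1) -> word (A 0) :=
  if n is m.+1 then comp_upto (n := m) \o s m.+1 else s 0.

Definition language : set (word (A 0)) :=
  [set w | exists n (a : A n.+1), infix w (comp_upto [:: a])].

(* x_n ... x_m, for n <= m *)
Definition window (x : fullshift (A 0)) (n m : int) : word (A 0) :=
  [seq x (n + i%:Z) | i <- iota 0 `|m - n|.+1].

Definition subshift_of : set (fullshift (A 0)) :=
  [set x | forall n m : int, n <= m -> language (window x n m)].

End directive_sequence.

(** Invariant and ergodic measures *)

Definition borel (A : alphabetType) :=
  g_sigma_algebraType (@open (fullshift A)).

Section measures.
Variables (R : realType) (A : alphabetType).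
Implicit Types (mu nu : probability (borel A) R) (X : set (fullshift A)).

Definition shift_invariant mu : Prop :=
  forall B : set (borel A), measurable B -> mu (@shift_map A @^-1` B) = mu B.

Definition ergodic mu : Prop :=
  forall B : set (borel A), measurable B ->
    @shift_map A @^-1` B = B -> mu B = 0%E \/ mu B = 1%E.

(* Leibniz inequality would be too weak here, since a [measure] also assigns
   unconstrained values to non-measurable sets. *)
Definition distinct_measures mu nu : Prop :=
  exists2 B : set (borel A), measurable B & mu B <> nu B.

(* Borel probability measures on a closed subset X of the full shift are
   viewed as Borel probability measures on the full shift that give X full
   mass. *)
Definition supports_ergodic_measures X (d : nat) : Prop :=
  exists mu : 'I_d -> probability (borel A) R,
    (forall i, [/\ mu i X = 1%E, shift_invariant (mu i) & ergodic (mu i)]) /\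
    (forall i j, i != j -> distinct_measures (mu i) (mu j)).

End measures.

(* Main.v *)
(** The letters are 0, ..., d-1. Two substitutions suffice: [D] doubles the letter
    0 and fixes the others, and [G] maps b to b+1, except that d-1 is mapped to
    0 1 ... d-1. Composing blocks D^k G, the image of one letter w is replaced
    by w^(2^k) t, where t is the concatenation of the images of the other
    letters, while those images are only relabelled cyclically, so that every
    letter has its turn once in d blocks. If k grows fast enough, the words
    w_n(i) following the letter i are, at each step, either unchanged or
    replaced by w_n(i)^N t with |t| negligible with respect to N |w_n(i)|.
    Since t contains the images of all other letters, the subshift is minimal.

    For fixed i, let nu_n be the uniform measure on the orbit of the periodic
    point of period w_n(i). A limit of the nu_n along an ultrafilter is an
    invariant measure mu_i. It is supported by the subshift, and it gives the
    letter i a frequency at least 3/4, so the mu_i are distinct. For mu_i-most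
    points x, a window of x of length |w_n(i)| is a factor of a power of
    w_n(i), hence visits a given clopen set a number of times which depends on
    n only. This forces invariant sets to be independent of all clopen sets, so
    of themselves, and mu_i is ergodic. *)
Require Import Defs.
From HB Require Import structures.
From mathcomp Require Import all_boot all_order all_algebra.
From mathcomp Require Import all_classical all_reals all_analysis.
From mathcomp Require Import measurable_realfun.
From mathcomp Require Import zify ring lra.

Set Implicit Arguments.
Unset Strict Implicit.
Unset Printing Implicit Defensive.

Import Order.TTheory GRing.Theory Num.Theory.
Import numFieldNormedType.Exports.

Local Open Scope classical_set_scope.
Local Open Scope ring_scope.

(** * Clopen sets of the full shift *)

Definition agree (A : alphabetType) (r : nat) (x y : fullshift A) :=
  forall k : int, (`|k| <= r)%N -> x k = y k.

(* By compactness, the local sets are exactly the clopen sets. *)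
Definition local (A : alphabetType) (C : set (fullshift A)) :=
  exists r, forall x y, agree r x y -> C x -> C y.

Section LocalSets.
Variable A : alphabetType.
Implicit Types (x y : fullshift A) (C D : set (fullshift A)).

Lemma agree_sym r x y : agree r x y -> agree r y x.
Proof. by move=> xy k kr; rewrite xy. Qed.

Lemma agree_le r s x y : (r <= s)%N -> agree s x y -> agree r x y.
Proof. by move=> rs xy k kr; apply: xy; exact: leq_trans rs. Qed.

Lemma local0 : local (set0 : set (fullshift A)).
Proof. by exists 0%N. Qed.

Lemma localC C : local C -> local (~` C).
Proof. by move=> [r Cr]; exists r => x y /agree_sym xy nCx /(Cr _ _ xy). Qed.

Lemma localU C D : local C -> local D -> local (C `|` D).
Proof.
move=> [r Cr] [s Ds]; exists (maxn r s) => x y xy [Cx|Dx].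
- by left; apply: Cr Cx; apply: agree_le xy; rewrite leq_maxl.
- by right; apply: Ds Dx; apply: agree_le xy; rewrite leq_maxr.
Qed.

Lemma localT : local (setT : set (fullshift A)).
Proof. by exists 0%N. Qed.

Lemma localI C D : local C -> local D -> local (C `&` D).
Proof.
by move=> lC lD; rewrite -[_ `&` _]setCK setCI; exact/localC/localU/localC/lD/localC.
Qed.

Lemma nbhs_agree r x : \forall y \near x, agree r x y.
Proof.
have near1 (k : int) : \forall y \near x, x k = y k.
  have /(_ [set b | x k = b]) := @proj_continuous int (fun=> discrete_topology A) k x.
  by apply; rewrite nbhs_principalE; apply/principal_filterP.
have : nbhs x [set y | forall i : 'I_r.+1, x i%:Z = y i%:Z /\ x (- i%:Z) = y (- i%:Z)].
  have := @filter_forall _ 'I_r.+1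
    (fun i y => x i%:Z = y i%:Z /\ x (- i%:Z) = y (- i%:Z)) (nbhs x).
  by apply=> i; apply: filterI; exact: near1.
apply: filterS => y xy k; rewrite -ltnS => kr.
have /= [xyp xyn] := xy (Ordinal kr).
by have [->|->] : k = `|k|%N \/ k = - `|k|%N%:Z by lia.
Qed.

Lemma local_open C : local C -> open C.
Proof.
move=> [r Cr]; rewrite openE => x Cx.
by apply: filterS (nbhs_agree r x) => y /Cr; exact.
Qed.

Lemma local_closed C : local C -> closed C.
Proof. by move=> lC; rewrite -[C]setCK; apply/open_closedC/local_open/localC. Qed.

Lemma agree_cvg x (y : nat -> fullshift A) :
  (forall r, agree r x (y r)) -> y @ \oo --> x.
Proof.
move=> xy; apply/cvg_sup => k B [_ [[W oW <-]] /= Wx] WB.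
exists `|k|%N => // r /= kr; apply: WB => /=.
by rewrite -(xy r).
Qed.

(** Otherwise points outside [O], agreeing with [x] on larger and larger windows, would converge to
    [x]. *)
Lemma nbhsP_agree x (O : set (fullshift A)) :
  nbhs x O -> exists r, agree r x `<=` O.
Proof.
move=> Ox; apply: contrapT => /forallNP /= nO.
have /choice[y yP] : forall r, exists y, agree r x y /\ ~ O y.
  by move=> r; have /existsNP[y /not_implyP] := nO r; exists y.
have [n _ /(_ n (leqnn n))] := agree_cvg (fun r => (yP r).1) Ox.
exact: (yP n).2.
Qed.

Lemma open_bigcup_local (O : set (fullshift A)) : open O ->
  exists F : (set (fullshift A))^nat, (forall n, local (F n)) /\ O = \bigcup_n F n.
Proof.
move=> oO; exists (fun r => [set x | agree r x `<=` O]); split.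
  move=> r; exists r => x y xy /= xO z yz; apply: xO => k kr.
  by rewrite xy // yz.
apply/seteqP; split => [x Ox|x [r _]]; last by apply=> k.
by have [r rO] := nbhsP_agree (open_nbhs_nbhs (conj oO Ox)); exists r.
Qed.

Lemma fullshift_compact : compact (setT : set (fullshift A)).
Proof.
have fA : compact (setT : set (discrete_topology A)).
  by apply: finite_compact; exact: (@finite_finset A).
have := @tychonoff int (fun=> discrete_topology A) (fun=> setT) (fun=> fA).
by rewrite (_ : mkset _ = setT) //; apply/seteqP; split.
Qed.

Lemma local_cover_finite C (F : (set (fullshift A))^nat) :
  local C -> (forall n, local (F n)) -> C `<=` \bigcup_n F n ->
  exists n, C `<=` \bigcup_(i < n) F i.
Proof.
move=> lC lF CF.
have : compact C by apply: (subclosed_compact (local_closed lC) fullshift_compact).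
rewrite compact_cover => /(_ nat setT F).
case=> [i _|//|D _ CD]; first exact: local_open.
exists (\max_(i <- finmap.enum_fset D) i.+1)%N => x /CD[i /= iD Fi]; exists i => //=.
by rewrite (@leq_bigmax_seq _ _ (fun=> true) (fun i : nat => i.+1)).
Qed.

End LocalSets.

(** * Borel measures determined on clopen sets *)

Fact local_display : measure_display. Proof. exact: default_measure_display. Qed.

(* The alias carries the algebra of local sets, to which Caratheodory's
   extension theorem is applied. *)
Definition local_algebra (A : alphabetType) : Type := fullshift A.

HB.instance Definition _ (A : alphabetType) := Pointed.on (local_algebra A).
HB.instance Definition _ (A : alphabetType) :=
  @isAlgebraOfSets.Build local_display (local_algebra A) (@local A)
    (local0 A) (@localU A) (@localC A).

(** Caratheodory's extension lives on the sigma-algebra generated by the local sets, [borel] on the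
    one generated by the open sets; each open set is a countable union of local ones. *)
Lemma borel_local (A : alphabetType) :
  @measurable _ (borel A) = <<s @local A >>.
Proof.
apply/seteqP; split.
  apply: smallest_sub => [|O oO]; first exact: smallest_sigma_algebra.
  have [F [lF ->]] := open_bigcup_local oO.
  by apply: sigma_algebra_bigcup => n; exact: sub_sigma_algebra.
apply: smallest_sub => [|C lC]; first exact: smallest_sigma_algebra.
by apply: sub_sigma_algebra; exact: local_open.
Qed.

Lemma measurable_local (A : alphabetType) (C : set (borel A)) :
  local C -> measurable C.
Proof. by rewrite borel_local; exact: sub_sigma_algebra. Qed.

Lemma measure_eq_local (R : realType) (A : alphabetType)
    (m1 m2 : {measure set (borel A) -> \bar R}) :
  (m1 setT < +oo)%E -> (forall C, local C -> m1 C = m2 C) ->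
  forall B, measurable B -> m1 B = m2 B.
Proof.
move=> m1T m12 B mB.
apply: (@measure_unique _ R (borel A) (@local A) (fun=> setT)) => //.
- exact: borel_local.
- exact: localI.
- by move=> _; exact: localT.
- by rewrite bigcup_const.
Qed.

(** * Extension of finitely additive contents *)

Section Extension.
Variables (R : realType) (A : alphabetType) (m : set (fullshift A) -> R).
Hypothesis m_ge0 : forall C, 0 <= m C.
Hypothesis mT : m setT = 1.
Hypothesis mU : forall C D, C `&` D = set0 -> m (C `|` D) = m C + m D.

Let m0 : m set0 = 0.
Proof. by have := mU (setI0 set0); rewrite setU0 => /eqP; lra. Qed.

Definition local_content (C : set (local_algebra A)) : \bar R := (m C)%:E.

Let content0 : local_content set0 = 0%E.
Proof. by rewrite /local_content m0. Qed.

Let content_ge0 C : (0 <= local_content C)%E.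
Proof. by rewrite lee_fin. Qed.

(* By compactness, a disjoint sequence of local sets whose union is local is
   eventually empty. *)
Let content_sigma_additive : semi_sigma_additive local_content.
Proof.
move=> F lF tF lUF.
have [n UFn] : exists n, \bigcup_k F k `<=` \bigcup_(i < n) F i.
  exact: local_cover_finite.
apply: cvg_near_cst; exists n => // k /= nk.
rewrite big_mkord -(_ : \bigcup_(i < k) F i = \bigcup_i F i); last first.
  apply/seteqP; split=> [x [i _ Fx]|]; first by exists i.
  move=> x /UFn[i /= ni Fx]; exists i => //=; exact: leq_trans nk.
rewrite bigcup_mkord; symmetry; elim: {nk} k => [|k IH].
  by rewrite !big_ord0.
rewrite !big_ord_recr /= -IH /local_content mU ?EFinD //.
rewrite -bigcup_mkord -subset0 => x [[/= i ik Fi] Fk].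
by move: ik; rewrite (tF i k I I) ?ltnn //; exists x.
Qed.

HB.instance Definition _ := isMeasure.Build _ _ R local_content
  content0 content_ge0 content_sigma_additive.

(** The extension is retyped over [borel A], since its native sigma-algebra equals the Borel one
    only through [borel_local]. *)
Definition local_measure : set (borel A) -> \bar R :=
  measure_extension local_content.

Let measure0 : local_measure set0 = 0%E.
Proof. exact: (measure0 (measure_extension local_content)). Qed.

Let measure_ge0 C : (0 <= local_measure C)%E.
Proof. exact: (measure_ge0 (measure_extension local_content)). Qed.

Let measure_sigma_additive : semi_sigma_additive local_measure.
Proof.
move=> F mF tF mUF.
apply: (measure_semi_sigma_additive (s := measure_extension local_content)) => //.
- by move=> i; have := mF i; rewrite borel_local.
- by rewrite borel_local in mUF.
Qed.

HB.instance Definition _ := isMeasure.Build _ (borel A) R local_measure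
  measure0 measure_ge0 measure_sigma_additive.

Lemma local_measureE C : local C -> local_measure C = (m C)%:E.
Proof. by move=> lC; rewrite /local_measure /measure_extension measurable_mu_extE. Qed.

Let measureT : local_measure setT = 1%E.
Proof. by rewrite local_measureE ?mT //; exact: localT. Qed.

HB.instance Definition _ :=
  Measure_isProbability.Build _ (borel A) R local_measure measureT.

Lemma content_extension : exists mu : probability (borel A) R,
  forall C, local C -> mu C = (m C)%:E.
Proof. by exists local_measure => C; exact: local_measureE. Qed.

End Extension.

(** * Ergodicity through numbers of visits *)

(** Both sides are the integral over [E] of the sum of the indicators of the [S k], which is
    constantly [c] on [E]. *)
Lemma sum_measure_count d (T : measurableType d) (R : realType)
    (mu : {measure set T -> \bar R}) (S : nat -> set T) (L c : nat) (E : set T) :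
  measurable E -> (forall k, measurable (S k)) ->
  (forall x, E x -> (\sum_(k < L) (x \in S k))%N = c) ->
  (\sum_(k < L) mu (E `&` S k) = c%:R%:E * mu E)%E.
Proof.
move=> mE mS Ec.
have -> : (c%:R%:E * mu E = \int[mu]_(x in E) (cst c%:R%:E) x)%E.
  by rewrite integral_cst.
transitivity (\int[mu]_(x in E) (\sum_(k < L) (\1_(S k) x)%:E))%E; last first.
  apply: eq_integral => x /set_mem Ex; rewrite sumEFin -(Ec x Ex) natr_sum.
  by congr EFin; apply: eq_bigr => k _; rewrite indicE.
rewrite ge0_integral_sum //.
  by apply: eq_bigr => k _; rewrite integral_indic // setIC.
move=> k; apply/measurable_EFinP; exact: measurable_indic.
Qed.

Section Shift.
Variables (A : alphabetType).
Implicit Types (C : set (fullshift A)).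

Lemma local_shift_pow (k : int) C : local C -> local (@shift_pow A k @^-1` C).
Proof.
move=> [r Cr]; exists (r + `|k|)%N => x y xy /=; apply: Cr => n nr.
by apply: xy; lia.
Qed.

Lemma shift_map_pow : @shift_map A = shift_pow 1.
Proof. by []. Qed.

Lemma shift_powD (k l : int) (x : fullshift A) :
  shift_pow k (shift_pow l x) = shift_pow (k + l) x.
Proof. by apply/funext => n; rewrite /shift_pow addrA. Qed.

Lemma measurable_shift_pow (k : int) (B : set (borel A)) :
  measurable B -> measurable (@shift_pow A k @^-1` B : set (borel A)).
Proof.
have mk : measurable_fun [set: borel A] (@shift_pow A k : borel A -> borel A).
  apply: (measurability _ (borel_local A)) => _ [C lC <-]; rewrite setTI.
  by apply: measurable_local; exact: local_shift_pow.
by move=> mB; rewrite -[X in measurable X]setTI; exact: mk.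
Qed.

Variables (R : realType) (mu : probability (borel A) R).

Lemma shift_invariant_local :
  (forall C, local C -> mu (@shift_map A @^-1` C) = mu C) -> shift_invariant mu.
Proof.
move=> muT.
have mf : measurable_fun [set: borel A] (@shift_map A : borel A -> borel A).
  by move=> _ B mB; rewrite setTI shift_map_pow; exact: measurable_shift_pow.
pose nu : {measure set (borel A) -> \bar R} :=
  measure_function_pushforward__canonical__measure_function_Measure mu mf.
move=> B mB; rewrite -[LHS]/(nu B).
apply: measure_eq_local mB => [|C lC].
  by rewrite (probability_setT mu : nu setT = 1%E) ltry.
exact: (muT C lC).
Qed.

Lemma shift_invariant_pow : shift_invariant mu ->
  forall (k : nat) (B : set (borel A)), measurable B ->
    mu (@shift_pow A k%:Z @^-1` B) = mu B.
Proof.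
move=> muT k B mB; elim: k => [|k IH].
  by congr (mu _); apply/seteqP; split=> x /=; rewrite shift_pow0.
rewrite -IH -[RHS]muT; last exact: measurable_shift_pow.
congr (mu _); apply/seteqP; split=> x /=;
  by rewrite shift_map_pow shift_powD intS addrC.
Qed.

Definition visits C (L : nat) (x : fullshift A) : nat :=
  (\sum_(k < L) (shift_pow k%:Z x \in C))%N.

Lemma visits_le C L x : (visits C L x <= L)%N.
Proof.
rewrite -[X in (_ <= X)%N]card_ord -sum1_card; apply: leq_sum => k _.
by case: (_ \in _).
Qed.

Lemma local_visits C L c : local C -> local [set x | visits C L x = c].
Proof.
move=> [r Cr]; exists (r + L)%N => x y xy <-; apply: eq_bigr => k _; congr nat_of_bool.
have kxy : agree r (shift_pow k%:Z x) (shift_pow k%:Z y).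
  by move=> n nr; apply: xy; have := ltn_ord k; lia.
by apply/idP/idP => /set_mem h; apply/mem_set; apply: Cr h => //; exact: agree_sym.
Qed.

Lemma probability_fineE (E : set (borel A)) :
  measurable E -> mu E = (fine (mu E))%:E.
Proof. by move=> mE; rewrite fineK //; exact: fin_num_measure. Qed.

Lemma probability_setI_ge (B G : set (borel A)) (e : R) :
  measurable B -> measurable G -> ((1 - e)%:E <= mu G)%E ->
  fine (mu B) - e <= fine (mu (B `&` G)) <= fine (mu B).
Proof.
move=> mB mG Ge.
have fmu := probability_fineE.
have mBG : measurable (B `&` G) by exact: measurableI.
have mBD : measurable (B `\` G) by exact: measurableD.
have mGC : measurable (~` G) by exact: measurableC.
have BE : fine (mu B) = fine (mu (B `&` G)) + fine (mu (B `\` G)).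
  apply: EFin_inj; rewrite EFinD -!fmu // -measureU //; last first.
    by rewrite setDE setIACA setICr setI0.
  by congr (mu _); rewrite setUIDK.
have DC : fine (mu (B `\` G)) <= 1 - fine (mu G).
  rewrite -lee_fin EFinB -!fmu // -probability_setC //.
  by apply: le_measure; rewrite ?inE //; exact: subDsetC.
have D0 : 0 <= fine (mu (B `\` G)) by exact: fine_ge0.
by move: Ge; rewrite fmu // lee_fin; lra.
Qed.

Section Criterion.
Hypothesis muT : shift_invariant mu.
Hypothesis mu_visits : forall C (e : R), local C -> 0 < e -> exists L c : nat,
  (0 < L)%N /\ ((1 - e)%:E <= mu [set x | visits C L x = c])%E.

(* [L mu(B & C)] is the sum over [k < L] of [mu(B & T^-k C)], and on the set
   where the number of visits is [c] these sets cover each point [c] times. *)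
Lemma visits_bounds (B : set (borel A)) C L c (e : R) :
  measurable B -> @shift_map A @^-1` B = B -> local C -> (0 < L)%N ->
  ((1 - e)%:E <= mu [set x | visits C L x = c])%E ->
  L%:R * (fine (mu (B `&` C)) - e)
    <= c%:R * fine (mu (B `&` [set x | visits C L x = c]))
    <= L%:R * fine (mu (B `&` C)).
Proof.
move=> mB TB lC L0; set G := [set x | _] => Ge; set g := fine (mu (B `&` G)).
have fmu := probability_fineE.
have mG : measurable (G : set (borel A)).
  by apply: measurable_local; exact: local_visits.
have mC : measurable (C : set (borel A)) by exact: measurable_local.
pose S (k : nat) : set (borel A) := @shift_pow A k%:Z @^-1` C.
have mS k : measurable (S k) by exact: measurable_shift_pow.
have BS k : @shift_pow A k%:Z @^-1` (B `&` C) = B `&` S k.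
  rewrite preimage_setI; congr (_ `&` _); elim: k => [|k IH].
    by apply/seteqP; split=> x /=; rewrite shift_pow0.
  rewrite -{2}TB -[in RHS]IH; apply/seteqP; split=> x /=;
  by rewrite shift_map_pow shift_powD intS addrC.
have muBS k : mu (B `&` S k) = mu (B `&` C).
  by rewrite -BS shift_invariant_pow //; exact: measurableI.
have sumE : \sum_(k < L) fine (mu ((B `&` S k) `&` G)) = c%:R * g.
  apply: EFin_inj; rewrite EFinM -fmu; last exact: measurableI.
  rewrite -(@sum_measure_count _ _ _ mu S L c) //; last 2 first.
  - exact: measurableI.
  - by move=> x [_ <-].
  transitivity (\sum_(k < L) (fine (mu ((B `&` S k) `&` G)))%:E)%E.
    by rewrite sumEFin.
  apply: eq_bigr => k _; rewrite -fmu; first by rewrite setIAC.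
  by apply: measurableI => //; exact: measurableI.
have sumL (z : R) : L%:R * z = \sum_(k < L) z.
  by rewrite sumr_const card_ord mulr_natl.
rewrite -sumE !sumL.
apply/andP; split; apply: ler_sum => k _; rewrite -(muBS k).
all: have := probability_setI_ge (measurableI _ _ mB (mS k)) mG Ge.
all: by case/andP.
Qed.

(** Applied to [B] and to the whole space, [visits_bounds] shows that [q = c / L] approximates
    [mu C], and that [q * mu B] approximates the mass of the intersection of [B] and [C]. *)
Lemma invariant_local_independent (B : set (borel A)) C :
  measurable B -> @shift_map A @^-1` B = B -> local C ->
  mu (B `&` C) = (mu B * mu C)%E.
Proof.
move=> mB TB lC.
have mC : measurable (C : set (borel A)) by exact: measurable_local.
have fmu := probability_fineE.
rewrite (fmu _ (measurableI _ _ mB mC)) (fmu _ mB) (fmu _ mC).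
rewrite -EFinM; congr EFin; apply/eqP; rewrite -subr_eq0 -normr_le0.
apply/ler_addgt0Pl => e e0; rewrite addr0.
(* The bound [e / 4] keeps the total error below [e]; the bound [1 / 2] makes the good set
   non-empty, whence [c <= L]. *)
have e4 : 0 < Num.min (e / 4) (1 / 2) by rewrite lt_min; apply/andP; split; lra.
have [L [c [L0 Ge]]] := mu_visits lC e4.
have := visits_bounds mB TB lC L0 Ge.
have := visits_bounds (@measurableT _ (borel A)) (preimage_setT _) lC L0 Ge.
rewrite !setTI /=.
set G := [set x | _] in Ge *.
have mG : measurable (G : set (borel A)).
  by apply: measurable_local; exact: local_visits.
have := probability_setI_ge mB mG Ge.
have := probability_setI_ge (@measurableT _ (borel A)) mG Ge.
rewrite !setTI [mu setT]probability_setT /=.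
have cL : (c <= L)%N.
  have /set0P[x <-] : G != set0.
    apply/eqP => G0; move: Ge; rewrite G0 measure0 lee_fin.
    have : Num.min (e / 4) (1 / 2) <= 1 / 2 by rewrite ge_min lexx orbT.
    lra.
  exact: visits_le.
have : Num.min (e / 4) (1 / 2) <= e / 4 by rewrite ge_min lexx.
have : fine (mu B) <= 1.
  by rewrite -lee_fin -fmu //; exact: probability_le1.
have : 0 <= fine (mu B) by exact: fine_ge0.
have q1 : c%:R / L%:R <= 1 :> R by rewrite ler_pdivrMr ?mul1r ?ler_nat ?ltr0n.
have q0 : 0 <= c%:R / L%:R :> R by rewrite divr_ge0.
have cE : c%:R = L%:R * (c%:R / L%:R) :> R by rewrite mulrC divfK // pnatr_eq0 -lt0n.
have L0' : 0 < L%:R :> R by rewrite ltr0n.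
move: e4; move: (Num.min _ _) => d.
move: (c%:R / L%:R) q0 q1 cE => q q0 q1 ->; rewrite -!mulrA !ler_pM2l //.
set b := fine (mu B); set g := fine (mu (B `&` G)); set h := fine (mu G).
set y := fine (mu C); set x := fine (mu (B `&` C)).
move=> d0 b0 b1 de /andP[h1 h2] /andP[g1 g2] /andP[y1 y2] /andP[x1 x2].
have qg1 : q * g <= q * b by exact: ler_wpM2l.
have qg2 : q * (b - d) <= q * g by exact: ler_wpM2l.
have qb1 : (y - d) * b <= q * b.
  by apply: ler_wpM2r => //; have := ler_wpM2l q0 h2; lra.
have qh := ler_wpM2l q0 h1.
have qd : q * d <= d by rewrite ler_piMl // ltW.
have qb2 : q * b <= (y + d) * b.
  by apply: ler_wpM2r => //; lra.
rewrite ler_norml; apply/andP; split; nra.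
Qed.

(** The restriction of [mu] to [B] and the multiple of [mu] by [mu B] agree on local sets, hence on
    [B] itself: [mu B] equals its square. *)
Lemma ergodic_visits : ergodic mu.
Proof.
move=> B mB TB.
have indep C : local C -> mu (B `&` C) = (mu B * mu C)%E.
  exact: invariant_local_independent.
have finB : mu B \is a fin_num by exact: fin_num_measure.
pose m1 : {measure set (borel A) -> \bar R} :=
  measure_function_mrestr__canonical__measure_function_Measure mu mB.
pose m2 : {measure set (borel A) -> \bar R} :=
  mscale (NngNum (fine_ge0 (measure_ge0 mu B))) mu.
have : m1 B = m2 B.
  apply: (@measure_eq_local R A m1 m2 _ _ B mB) => [|C lC].
    by rewrite [m1 _]/(mu (setT `&` B)) setTI ltey_eq finB.
  transitivity (mu (B `&` C)); first by congr (mu _); exact: setIC.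
  transitivity (mu B * mu C)%E; first exact: indep.
  by rewrite /m2 /= /mscale /= fineK.
rewrite [m1 B]/(mu (B `&` B)) setIid /m2 /= /mscale /= fineK //.
rewrite -(fineK finB) -EFinM => bE.
have bb : fine (mu B) = fine (mu B) * fine (mu B) := congr1 fine bE.
have /eqP : fine (mu B) * (fine (mu B) - 1) = 0 by rewrite mulrBr mulr1 -bb subrr.
rewrite mulf_eq0 subr_eq0 => /orP[] /eqP ->; by [left|right].
Qed.

End Criterion.

End Shift.

(** * Invariant limits of uniform measures on periodic orbits *)

(** By compactness the image ultrafilter has a cluster point, and an ultrafilter converges to its
    cluster points. *)
Lemma ultra_cvg_itv (R : realType) (U : set_system nat) (u : nat -> R) :
  UltraFilter U -> (forall n, 0 <= u n <= 1) -> exists l : R, u @ U --> l.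
Proof.
move=> UU u01.
have [|l [_ ul]] := @segment_compact R 0 1 (u @ U) _.
  by apply: (@filterE _ U) => n; rewrite /= in_itv /=; exact: u01.
exists l => V Vl; have [//|UnV] := in_ultra_setVsetC (u @^-1` V) UU.
by have [x [nVx Vx]] := ul (~` V) V UnV Vl.
Qed.

(** An ultrafilter finer than [\oo] yields limits for all sets at once, so additivity and invariance
    pass to the limit without extracting subsequences. *)
Lemma krylov_bogoliubov (R : realType) (A : alphabetType)
    (nu : nat -> set (fullshift A) -> R) :
  (forall n C, 0 <= nu n C) -> (forall n, nu n setT = 1) ->
  (forall n C D, C `&` D = set0 -> nu n (C `|` D) = nu n C + nu n D) ->
  (forall n C, nu n (@shift_map A @^-1` C) = nu n C) ->
  exists mu : probability (borel A) R, shift_invariant mu /\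
    forall C c, local C -> (\forall n \near \oo, c <= nu n C) -> (c%:E <= mu C)%E.
Proof.
move=> nu0 nuT nuU nuS.
have [U [UU ooU]] := @ultraFilterLemma _ \oo _.
have /choice[m mP] : forall C, exists l : R, nu^~ C @ U --> l.
  move=> C; apply: ultra_cvg_itv => // n; rewrite nu0 -(nuT n).
  by rewrite -(setUv C) nuU ?setICr // lerDl nu0.
have mE C (l : R) : nu^~ C @ U --> l -> m C = l.
  by move=> Cl; exact: cvg_unique (mP C) Cl.
have [|||mu muE] := @content_extension R A m.
- by move=> C; apply: cvgr_to_ge (mP C) _; apply: (@filterE _ U) => n; exact: nu0.
- by apply: mE; rewrite (_ : nu^~ setT = cst 1) ?funeqE //; exact: cvg_cst.
- move=> C D CD; apply: mE; rewrite (_ : nu^~ _ = nu^~ C \+ nu^~ D).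
    exact: cvgD.
  by apply/funext => n; exact: nuU.
exists mu; split=> [|C c lC cC].
  apply: shift_invariant_local => C lC; rewrite !muE //.
    by congr EFin; apply: mE; under eq_fun do rewrite nuS; exact: mP.
  exact: (@local_shift_pow A 1).
by rewrite muE // lee_fin; apply: cvgr_to_ge (mP C) _; exact: ooU.
Qed.

Lemma leq_in_count (T : eqType) (a b : pred T) (s : seq T) :
  {in s, forall x, a x -> b x} -> (count a s <= count b s)%N.
Proof.
move=> ab; rewrite -(eq_in_count (_ : {in s, predI a (mem s) =1 a})).
  by apply: sub_count => x /andP[/= ax xs]; exact: ab.
by move=> x /= ->; rewrite andbT.
Qed.

(** * Periodic points, visit frequencies and occurrences of words *)

Section Periodic.
Variable A : alphabetType.
Implicit Types (C : set (fullshift A)) (w : seq A) (x : fullshift A).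

Definition per w : fullshift A := fun z => nth point w `|(z %% (size w)%:Z)%Z|.

Definition prefix_of (l : nat) x : seq A := [seq x i%:Z | i <- iota 0 l].

Lemma local_prefix (P : set (seq A)) l : local [set x | P (prefix_of l x)].
Proof.
exists l => x y xy /=; rewrite (_ : prefix_of l x = prefix_of l y) //.
by apply/eq_in_map => i; rewrite mem_iota => il; apply: xy; lia.
Qed.

Lemma per_period w (j : int) : shift_pow (j * (size w)%:Z) (per w) = per w.
Proof. by apply/funext => z; rewrite /shift_pow /per addrC modzMDl. Qed.

(** The visit lost at time 0 is regained at time [L], by periodicity. *)
Lemma visits_shift C L x : shift_pow L%:Z x = x ->
  visits C L (shift_map x) = visits C L x.
Proof.
move=> xL; rewrite /visits; case: L xL => [|L] xL; first by rewrite !big_ord0.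
rewrite big_ord_recr big_ord_recl /= addnC; congr (_ + _)%N.
  by rewrite shift_map_pow shift_powD [_ + 1]addrC -intS xL shift_pow0.
by apply: eq_bigr => k _; rewrite shift_map_pow shift_powD [_ + 1]addrC -intS.
Qed.

Lemma visits_per_nat C w (k : nat) :
  visits C (size w) (shift_pow k%:Z (per w)) = visits C (size w) (per w).
Proof.
elim: k => [|k IH]; first by rewrite shift_pow0.
rewrite -IH -(@visits_shift C _ (shift_pow k%:Z (per w))).
  by rewrite shift_map_pow shift_powD intS.
by rewrite !shift_powD addrC -shift_powD -[X in shift_pow X (per w)]mul1r per_period.
Qed.

Lemma prefix_per w (k l : nat) : (k + l <= size w)%N ->
  prefix_of l (shift_pow k%:Z (per w)) = take l (drop k w).
Proof.
move=> kl; apply: (@eq_from_nth A point) => [|i].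
  by rewrite size_map size_iota size_takel ?size_drop //; lia.
rewrite size_map size_iota => il.
rewrite (nth_map 0%N) ?size_iota // nth_iota // nth_take // nth_drop /shift_pow /per.
by congr nth; rewrite -PoszD modz_nat absz_nat modn_small //; lia.
Qed.

Lemma size_flatten_nseq (n : nat) (u : seq A) :
  size (flatten (nseq n u)) = (n * size u)%N.
Proof. by elim: n => //= n IH; rewrite size_cat IH mulSn. Qed.

Lemma nth_flatten_nseq (u : seq A) n k : (k < n * size u)%N ->
  nth point (flatten (nseq n u)) k = nth point u (k %% size u).
Proof.
elim: n k => [|n IH] k; first by rewrite mul0n.
rewrite mulSn /= nth_cat => kn; case: ltnP => ku; first by rewrite modn_small.
by rewrite IH ?ltn_subLR // -[in RHS](subnK ku) modnDr.
Qed.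

Lemma take_drop_flatten_nseq (u v : seq A) n k l : (k + l <= n * size u)%N ->
  take l (drop k (flatten (nseq n u) ++ v)) = prefix_of l (shift_pow k%:Z (per u)).
Proof.
move=> kl; apply: (@eq_from_nth A point) => [|i].
  by rewrite size_map size_iota size_takel ?size_drop // size_cat size_flatten_nseq; lia.
rewrite size_takel ?size_drop ?size_cat ?size_flatten_nseq; last by lia.
move=> il; rewrite nth_take // nth_drop nth_cat size_flatten_nseq.
have kin : (k + i < n * size u)%N by lia.
rewrite kin nth_flatten_nseq // (nth_map 0%N) ?size_iota // nth_iota // add0n.
by rewrite /shift_pow /per -PoszD modz_nat absz_nat addnC.
Qed.

Lemma per_mod (u : seq A) (k : nat) :
  shift_pow k%:Z (per u) = shift_pow (k %% size u)%N%:Z (per u).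
Proof.
by rewrite [in LHS](divn_eq k (size u)) addnC PoszD PoszM -shift_powD per_period.
Qed.

Variable R : realType.

(** The uniform probability on the orbit of [per w], for [w] non-empty; [size w] need not be the
    least period, as each orbit point is then counted equally often. *)
Definition freq w C : R := (visits C (size w) (per w))%:R / (size w)%:R.

Lemma freq_ge0 w C : 0 <= freq w C.
Proof. by rewrite divr_ge0. Qed.

Lemma freqT w : w != [::] -> freq w setT = 1.
Proof.
move=> w0; rewrite /freq /visits (eq_bigr (fun=> 1%N)) => [|k _]; last first.
  by rewrite in_setT.
by rewrite sum1_card card_ord divff // pnatr_eq0 size_eq0.
Qed.

Lemma freqU w C D : C `&` D = set0 -> freq w (C `|` D) = freq w C + freq w D.
Proof.
move=> CD; rewrite /freq -mulrDl -natrD /visits -big_split /=.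
congr (_%:R / _); apply: eq_bigr => k _; rewrite in_setU.
case: (boolP (_ \in C)) => //= /set_mem Cx; case: (boolP (_ \in D)) => //= /set_mem Dx.
by have : (C `&` D) (shift_pow k%:Z (per w)) by []; rewrite CD.
Qed.

Lemma freq_shift_pow w C (k : nat) : freq w (shift_pow k%:Z @^-1` C) = freq w C.
Proof.
rewrite /freq; congr (_%:R / _); rewrite -(visits_per_nat C w k).
by apply: eq_bigr => i _; congr nat_of_bool; rewrite shift_powD addrC -shift_powD.
Qed.

(* Occurrences inside [w], not cyclically: this is what makes [occ]
   superadditive. *)
Definition occ (P : pred (seq A)) (l : nat) w : nat :=
  count (fun k => (k + l <= size w)%N && P (take l (drop k w))) (iota 0 (size w)).

Lemma occ_le P l w : (occ P l w <= size w)%N.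
Proof. by rewrite -[X in (_ <= X)%N](size_iota 0); exact: count_size. Qed.

Lemma occ_cat P l u v : (occ P l u + occ P l v <= occ P l (u ++ v))%N.
Proof.
rewrite /occ size_cat iotaD count_cat add0n; apply: leq_add.
  apply: leq_in_count => k; rewrite mem_iota add0n => /andP[_ ku] /andP[kl].
  rewrite (leq_trans kl (leq_addr _ _)) /=.
  by rewrite drop_cat ku takel_cat // size_drop; lia.
have -> : iota (size u) (size v) = [seq (size u + k)%N | k <- iota 0 (size v)].
  by rewrite -iotaDl addn0.
rewrite count_map; apply: sub_count => k /= /andP[kl].
by rewrite -addnA leq_add2l kl drop_cat ltnNge leq_addr /= addKn.
Qed.

Lemma occ_nseq P l (n : nat) w : (n * occ P l w <= occ P l (flatten (nseq n w)))%N.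
Proof.
elim: n => [|n IH] //=; rewrite mulSn; apply: leq_trans (occ_cat _ _ _ _).
by rewrite leq_add2l.
Qed.

Lemma occ_freq (P : pred (seq A)) l w C : (forall x, P (prefix_of l x) -> C x) ->
  (occ P l w)%:R / (size w)%:R <= freq w C.
Proof.
move=> PC; rewrite ler_wpM2r ?invr_ge0 // ler_nat /occ /visits -sum1_count.
rewrite -(big_mkord xpredT (fun k : nat => nat_of_bool (shift_pow k%:Z (per w) \in C))).
rewrite /index_iota subn0 big_mkcond /=; apply: leq_sum => k _.
case: ifP => // /andP[kl Pk]; rewrite mem_set //; apply: PC.
by rewrite prefix_per.
Qed.

Lemma occ_ge (P : pred (seq A)) l u (n : nat) : (n <= size u)%N ->
  (forall k, (k + l <= n)%N -> P (take l (drop k u))) ->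
  (n - l <= occ P l u)%N.
Proof.
move=> nu Pu; rewrite /occ -[X in iota _ X](subnKC (leq_trans (leq_subr l n) nu)).
rewrite iotaD count_cat; apply: leq_trans (leq_addr _ _).
rewrite -[X in (X <= _)%N](size_iota 0) -count_predT; apply: leq_in_count => k.
rewrite mem_iota add0n /= => kn _; have kl : (k + l <= n)%N by lia.
by rewrite Pu // andbT; exact: leq_trans nu.
Qed.

End Periodic.

(** * Rank-one measures *)

Section RankOne.
Variables (R : realType) (A : alphabetType).
Variables (w : nat -> seq A) (N : nat -> nat) (t : nat -> seq A).
Hypothesis w0 : w 0 != [::].
Hypothesis wS : forall n, w n.+1 = flatten (nseq (N n) (w n)) ++ t n.
Hypothesis N_gt0 : forall n, (0 < N n)%N.
(** The relative errors [2 ^- n.+3] sum to [2 ^- n.+2] over the levels from [n] on. *)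
Hypothesis t_small : forall n, (size (t n) * 2 ^ n.+3 <= N n * size (w n))%N.
(** Asked for infinitely many levels only: between its turns a word stays unchanged, with
    [N n = 1]. *)
Hypothesis N_large : forall n, exists2 m, (n <= m)%N & (2 ^ m.+3 <= N m)%N.

Lemma size_wS n : size (w n.+1) = (N n * size (w n) + size (t n))%N.
Proof. by rewrite wS size_cat size_flatten_nseq. Qed.

Lemma size_w_gt0 n : (0 < size (w n))%N.
Proof.
elim: n => [|n IH]; first by rewrite lt0n size_eq0.
by rewrite size_wS ltn_addr // muln_gt0 N_gt0.
Qed.

Lemma leq_size_w n m : (n <= m)%N -> (size (w n) <= size (w m))%N.
Proof.
elim: m => [|m IH]; first by rewrite leqn0 => /eqP ->.
rewrite leq_eqVlt => /predU1P[-> //|]; rewrite ltnS => /IH /leq_trans; apply.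
by rewrite size_wS (leq_trans _ (leq_addr _ _)) // leq_pmull.
Qed.

(** The length at least doubles whenever [2 <= N m], which happens infinitely often. *)
Lemma size_w_large K : exists n, forall m, (n <= m)%N -> (K <= size (w m))%N.
Proof.
suff [n Kn] : exists n, (K <= size (w n))%N.
  by exists n => m /leq_size_w; exact: leq_trans.
elim: K => [|K [n Kn]]; first by exists 0%N.
have [m nm Nm] := N_large n; exists m.+1.
have := leq_size_w nm; have := size_w_gt0 m; rewrite size_wS.
have : (2 <= N m)%N by apply: leq_trans Nm; rewrite !expnS; lia.
nia.
Qed.

Lemma pow2E n : 2 ^- n.+1 = 2 ^- n / 2 :> R.
Proof. by rewrite exprSr invfM. Qed.

Lemma pow2_gt0 n : 0 < 2 ^- n :> R.
Proof. by rewrite invr_gt0 exprn_gt0. Qed.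

Notation ratio P l n := ((occ P l (w n))%:R / (size (w n))%:R : R).

(* The error term is chosen so that the corrected ratios are nondecreasing. *)
Lemma occ_ratioS P l n : ratio P l n - 2 ^- n.+2 <= ratio P l n.+1 - 2 ^- n.+3.
Proof.
suff : ratio P l n - 2 ^- n.+3 <= ratio P l n.+1 by rewrite [2 ^- n.+3]pow2E; lra.
have h0 : 0 < (size (w n))%:R :> R by rewrite ltr0n size_w_gt0.
have h'0 : 0 < (size (w n.+1))%:R :> R by rewrite ltr0n size_w_gt0.
rewrite ler_pdivlMr //.
have oN : (N n)%:R * (occ P l (w n))%:R <= (occ P l (w n.+1))%:R :> R.
  rewrite -natrM ler_nat wS; apply: leq_trans (occ_nseq _ _ _ _) _.
  exact: leq_trans (leq_addr _ _) (occ_cat _ _ _ _).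
apply: le_trans oN; set q := ratio P l n.
have q0 : 0 <= q by rewrite divr_ge0.
have q1 : q <= 1 by rewrite ler_pdivrMr // mul1r ler_nat occ_le.
have -> : (occ P l (w n))%:R = q * (size (w n))%:R :> R.
  by rewrite divfK // gt_eqF.
have ht : (size (t n))%:R <= 2 ^- n.+3 * ((N n)%:R * (size (w n))%:R) :> R.
  rewrite mulrC ler_pdivlMr ?exprn_gt0 // -natrX -!natrM ler_nat.
  exact: t_small.
rewrite size_wS natrD natrM; have := pow2_gt0 n.+3.
move: (2 ^- n.+3) ht => e ht e0.
have t0 : 0 <= (size (t n))%:R :> R by [].
have : q * (size (t n))%:R <= (size (t n))%:R by rewrite ler_piMl.
have : 0 <= e * (size (t n))%:R by rewrite mulr_ge0 // ltW.
lra.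
Qed.

Lemma occ_ratio P l n m : (n <= m)%N -> ratio P l n - 2 ^- n.+2 <= ratio P l m.
Proof.
move=> nm; apply: (@le_trans _ _ (ratio P l m - 2 ^- m.+2)); last first.
  by rewrite gerBl ltW // pow2_gt0.
elim: m nm => [|m IH]; first by rewrite leqn0 => /eqP ->.
rewrite leq_eqVlt => /predU1P[-> //|]; rewrite ltnS => /IH /le_trans; apply.
exact: occ_ratioS.
Qed.

Section LimitMeasure.
Variable mu : probability (borel A) R.
Hypothesis mu_ge : forall C c, local C ->
  (\forall n \near \oo, c <= freq R (w n) C) -> (c%:E <= mu C)%E.

Lemma mu_occ_ge (P : pred (seq A)) l C c n : local C ->
  (forall x, P (prefix_of l x) -> C x) ->
  (forall m, (n <= m)%N -> c <= ratio P l m) -> (c%:E <= mu C)%E.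
Proof.
move=> lC PC cP; apply: mu_ge => //; exists n => // m /= /cP /le_trans; apply.
exact: occ_freq.
Qed.

(** The ratio is 1 at level 0, and all later levels together cost at most [2 ^- 2]. *)
Lemma mu_letter a : w 0 = [:: a] ->
  ((3 / 4)%:E <= mu [set x : fullshift A | x 0%R = a])%E.
Proof.
move=> w0a; apply: (@mu_occ_ge (pred1 [:: a]) 1 _ _ 0).
- have := @local_prefix A (fun v => v = [:: a]) 1; congr local.
  by apply/seteqP; split=> x /= [<-].
- by move=> x /= /eqP[].
move=> m m0; apply: le_trans (occ_ratio _ _ m0).
by rewrite w0a /occ /= eqxx /=; lra.
Qed.

(** At most [l] windows starting in [w m] run over its end, a negligible number compared with
    [size (w m)]. *)
Lemma mu_factor l :
  mu [set x : fullshift A | exists m, infix (prefix_of l x) (w m)] = 1%E.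
Proof.
have mE := measurable_local (@local_prefix A (fun v => exists m, infix v (w m)) l).
apply/eqP; rewrite eq_le probability_le1 //=; apply/lee_addgt0Pr => e e0.
rewrite -leeBlDr // -EFinB.
have [n nP] := size_w_large (Num.bound (l%:R / e)).
apply: (@mu_occ_ge (fun v => `[< exists m, infix v (w m) >]) l _ _ n).
- exact: (@local_prefix A (fun v => exists m, infix v (w m))).
- by move=> x /asboolP.
move=> m /nP hm; have h0 : 0 < (size (w m))%:R :> R by rewrite ltr0n size_w_gt0.
have lo : (size (w m) <= l + occ (fun v => `[< exists m, infix v (w m) >]) l (w m))%N.
  rewrite -leq_subLR; apply: occ_ge => // k _.
  apply/asboolP; exists m; apply/infixP.
  by exists (take k (w m)), (drop l (drop k (w m))); rewrite !cat_take_drop.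
rewrite ler_pdivlMr //.
have : l%:R <= e * (size (w m))%:R.
  rewrite mulrC -ler_pdivrMr //; apply: le_trans (_ : (Num.bound (l%:R / e))%:R <= _).
    by rewrite ltW // archi_boundP // divr_ge0 // ltW.
  by rewrite ler_nat.
by move: lo; rewrite -(ler_nat R) natrD; lra.
Qed.

(* A window of length [L + 2 r] read in a power of [w n] determines the visits
   of [L = size (w n)] consecutive points to a set of radius [r]; their number is
   that of a full period of [per (w n)]. Only a small proportion of the windows
   of [w m], [n < m], are not read in such a power. *)
Lemma mu_visits : shift_invariant mu ->
  forall C (e : R), local C -> 0 < e -> exists L c : nat,
  (0 < L)%N /\ ((1 - e)%:E <= mu [set x | visits C L x = c])%E.
Proof.
move=> muT C e lC e0; have [r Cr] := lC.
have [n1 n1P] := size_w_large r.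
(* A level where [w n] is repeated often, with [r <= size (w n)] and [2 ^- n <= e]. *)
have [n n1n Nn] := N_large (maxn n1 (Num.bound e^-1)).
have rL : (r <= size (w n))%N by apply: n1P; lia.
have en : 2 ^- n <= e.
  rewrite -[e]invrK lef_pV2 ?posrE ?invr_gt0 ?exprn_gt0 //.
  apply: le_trans (_ : (Num.bound e^-1)%:R <= _).
    by rewrite ltW // archi_boundP // invr_ge0 ltW.
  by rewrite -natrX ler_nat ltnW // (leq_ltn_trans _ (ltn_expl n _)) //; lia.
pose L := size (w n); pose l := (L + r.*2)%N; pose y := per (w n).
exists L, (visits C L y); split; first exact: size_w_gt0.
set G := [set x | _].
have lG : local G by exact: local_visits.
(* [G] depends on coordinates from [- r] on; the translation by [r] turns this into a condition on
   the prefix of length [l]. *)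
rewrite -(shift_invariant_pow muT r (measurable_local lG)).
pose P := fun v => [exists j : 'I_L, v == prefix_of l (shift_pow j%:Z y)].
apply: (@mu_occ_ge P l _ _ n.+1); first exact: local_shift_pow.
  move=> x /existsP[j /eqP /eq_in_map xj].
  rewrite /= /G /= -(visits_per_nat C (w n) (j + r)) -/y -/L.
  apply: eq_bigr => k _; congr nat_of_bool; rewrite !shift_powD.
  have kxy : agree r (shift_pow (k%:Z + r%:Z) x) (shift_pow (k%:Z + (j + r)%:Z) y).
    move=> i ir; rewrite /shift_pow.
    have := ltn_ord k; move=> kL.
    have il : (absz (i + (k%:Z + r%:Z))) \in iota 0 l by rewrite mem_iota /l; lia.
    have -> : i + (k%:Z + r%:Z) = (absz (i + (k%:Z + r%:Z)))%:Z by lia.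
    by rewrite (xj _ il) /shift_pow; congr y; lia.
  by apply/idP/idP => /set_mem h; apply/mem_set; apply: Cr h => //; exact: agree_sym.
have NL : (N n * L - l <= occ P l (w n.+1))%N.
  apply: occ_ge => [|k kl]; first by rewrite size_wS leq_addr.
  rewrite wS take_drop_flatten_nseq //; apply/existsP.
  have kL : (k %% L < L)%N by rewrite ltn_pmod // size_w_gt0.
  by exists (Ordinal kL); rewrite per_mod.
move=> m nm; apply: le_trans (occ_ratio _ _ nm).
(* In [w n.+1], the windows leaving the power cost at most [l <= 3 * L] positions, a proportion of
   at most [3 * 2 ^- n.+3], and [t n] costs at most [2 ^- n.+3]. All later levels cost another
   [2 ^- n.+3], for a total below [2 ^- n]. *)
suff : 1 - 2 ^- n.+1 <= ratio P l n.+1 by rewrite !pow2E in en *; lra.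
have h0 : 0 < (size (w n.+1))%:R :> R by rewrite ltr0n size_w_gt0.
rewrite ler_pdivlMr //.
have ht : (size (t n))%:R <= 2 ^- n.+3 * ((N n)%:R * L%:R) :> R.
  by rewrite mulrC ler_pdivlMr ?exprn_gt0 // -natrX -!natrM ler_nat t_small.
have oN : (N n)%:R * L%:R - 3 * L%:R <= (occ P l (w n.+1))%:R :> R.
  by rewrite -!natrM lerBlDr -natrD ler_nat; move: NL; rewrite /l -/L in rL *; lia.
have N1 : 1 <= 2 ^- n.+3 * (N n)%:R :> R.
  by rewrite mulrC ler_pdivlMr ?exprn_gt0 // mul1r -natrX ler_nat.
apply: le_trans oN; rewrite size_wS natrD natrM -/L.
have -> : 2 ^- n.+1 = 4 * 2 ^- n.+3 :> R by rewrite !pow2E; lra.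
have L0 : 0 <= L%:R :> R by [].
have t0 : 0 <= (size (t n))%:R :> R by [].
move: (2 ^- n.+3) (pow2_gt0 n.+3) ht N1 => d d0 ht N1.
have : 0 <= d * (size (t n))%:R by rewrite mulr_ge0 // ltW.
have := ler_wpM2r L0 N1; lra.
Qed.

End LimitMeasure.

Lemma rank_one_measure : exists mu : probability (borel A) R,
  [/\ shift_invariant mu, ergodic mu,
      forall l, mu [set x : fullshift A | exists m, infix (prefix_of l x) (w m)] = 1%E &
      forall a, w 0 = [:: a] -> ((3 / 4)%:E <= mu [set x : fullshift A | x 0%R = a])%E].
Proof.
have wn n : w n != [::] by rewrite -size_eq0 -lt0n size_w_gt0.
have [||||mu [muT mu_ge]] := @krylov_bogoliubov R A (fun n => freq R (w n)).
- by move=> n C; exact: freq_ge0.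
- by move=> n; exact: freqT.
- by move=> n C D; exact: freqU.
- by move=> n C; exact: (freq_shift_pow _ _ _ 1).
exists mu; split=> //.
- by apply: ergodic_visits => //; exact: mu_visits.
- by move=> l; exact: mu_factor.
- by move=> a; exact: mu_letter.
Qed.

End RankOne.

(** * Minimality of S-adic subshifts *)

(** The piece in which [u] begins covers at most [B] of its letters; the next piece, of length at
    most [B], fits entirely in what remains. *)
Lemma infix_flatten (T : eqType) (B : nat) (ss : seq (seq T)) (u : seq T) :
  {in ss, forall v, size v <= B}%N -> (2 * B < size u)%N ->
  infix u (flatten ss) -> exists2 v, v \in ss & infix v u.
Proof.
move=> + Bu /infixP[x [y]]; elim: ss x => [|v ss IH] x vB /=.
  by move=> /esym/(congr1 size); rewrite !size_cat /=; lia.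
have vB' : {in ss, forall v, size v <= B}%N.
  by move=> v' v'ss; apply: vB; rewrite in_cons v'ss orbT.
have [vx|xv] := leqP (size v) (size x).
  rewrite -(cat_take_drop (size v) x) -catA => /eqP.
  rewrite eqseq_cat ?size_takel // => /andP[_ /eqP E].
  by have [v' v'ss v'u] := IH _ vB' E; exists v' => //; rewrite in_cons v'ss orbT.
have vB1 : (size v <= B)%N by apply: vB; rewrite mem_head.
rewrite -(cat_take_drop (size x) v) -catA => /eqP.
rewrite eqseq_cat ?size_takel 1?ltnW // => /andP[_].
set v1 := drop _ v; have v1B : (size v1 <= B)%N by rewrite size_drop; lia.
rewrite -(cat_take_drop (size v1) u) -catA.
rewrite eqseq_cat ?size_takel //; last by lia.
case/andP => _; set u2 := drop _ u.
have u2B : (B < size u2)%N by rewrite size_drop; lia.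
case: ss vB {IH vB'} => [|v' ss] vB /=.
  by move=> /eqP/(congr1 size); rewrite size_cat /=; lia.
have vB' : (size v' <= B)%N by apply: vB; rewrite !in_cons eqxx orbT.
rewrite -(cat_take_drop (size v') u2) -catA.
rewrite eqseq_cat ?size_takel //; last by lia.
case/andP => /eqP v'E _; exists v'; first by rewrite !in_cons eqxx orbT.
apply/infixP; exists (take (size v1) u), (drop (size v') u2).
by rewrite -v'E.
Qed.

Section Directive.
Variables (A : alphabetType) (s : nat -> substitution A A).
Implicit Types (x y : fullshift A) (u v : seq A).
Local Notation L := (@language (fun=> A) s).
Local Notation X := (@subshift_of (fun=> A) s).

(** Unlike [comp_upto], this includes the empty composition, so that [n] counts the
    substitutions. *)
Fixpoint img n : seq A -> seq A := if n is m.+1 then img m \o s m else id.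

Lemma substitution_cat (f : substitution A A) u v : f (u ++ v) = f u ++ f v.
Proof. exact: (@gmulfM (word A) (word A) f u v). Qed.

Lemma img_cat n u v : img n (u ++ v) = img n u ++ img n v.
Proof. by elim: n u v => //= n IH u v; rewrite substitution_cat IH. Qed.

Lemma substitution_nil (f : substitution A A) : f [::] = [::].
Proof. exact: (@gmulf1 (word A) (word A) f). Qed.

Lemma img_nil n : img n [::] = [::].
Proof. by elim: n => //= n IH; rewrite substitution_nil. Qed.

Lemma img_flatten n u : img n u = flatten [seq img n [:: a] | a <- u].
Proof. by elim: u => [|a u IH]; rewrite ?img_nil // -cat1s img_cat IH. Qed.

Lemma comp_upto_img n u : @comp_upto (fun=> A) s n u = img n.+1 u.
Proof. by elim: n u => //= n IH u; rewrite IH. Qed.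

Lemma language_infix u v : infix u v -> L v -> L u.
Proof. by move=> uv [n [a av]]; exists n, a; exact: infix_trans av. Qed.

Lemma size_prefix_of l x : size (prefix_of l x) = l.
Proof. by rewrite size_map size_iota. Qed.

Lemma window_prefix x (n m : int) :
  @window (fun=> A) x n m = prefix_of (absz (m - n)).+1 (shift_pow n x).
Proof. by apply: eq_map => i; rewrite /shift_pow addrC. Qed.

Lemma prefix_of_infix (k l r : nat) x : (k + l <= r)%N ->
  infix (prefix_of l (shift_pow k%:Z x)) (prefix_of r x).
Proof.
move=> klr; apply/infixP.
exists (prefix_of k x), (prefix_of (r - (k + l)) (shift_pow (k + l)%N%:Z x)).
have pD m n z : prefix_of (m + n) z = prefix_of m z ++ prefix_of n (shift_pow m%:Z z).
  rewrite /prefix_of iotaD map_cat add0n; congr (_ ++ _).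
  rewrite -[X in iota X n]addn0 iotaDl -map_comp; apply: eq_map => i /=.
  by rewrite /shift_pow addnC.
by rewrite -{1}(subnKC klr) !pD -catA.
Qed.

(** Every window lies in a centred one; a countable family of clopen conditions is left. *)
Lemma subshift_ofP x :
  X x <-> forall r : nat, L (prefix_of r.*2.+1 (shift_pow (- r%:Z) x)).
Proof.
split=> [Xx r|Lx n m nm].
  have rr : - r%:Z <= r%:Z by lia.
  by have := Xx _ _ rr; rewrite window_prefix (_ : absz _ = r.*2) //; lia.
rewrite window_prefix; pose r := (absz n + absz m)%N.
apply: language_infix (Lx r).
rewrite (_ : shift_pow n x = shift_pow (absz (n + r%:Z))%:Z (shift_pow (- r%:Z) x)).
  by apply: prefix_of_infix; rewrite /r; lia.
by rewrite shift_powD; congr (shift_pow _ x); rewrite /r; lia.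
Qed.

Lemma subshift_of_closed : closed X.
Proof.
have -> : X = \bigcap_(r in setT) [set x | L (prefix_of r.*2.+1 (shift_pow (- r%:Z) x))].
  apply/seteqP; split=> x; first by move=> /subshift_ofP Xx r _; exact: Xx.
  by move=> Xx; apply/subshift_ofP => r; exact: Xx.
apply: closed_bigI => r _; apply: local_closed.
apply: (@local_shift_pow A (- r%:Z) [set x | L (prefix_of r.*2.+1 x)]).
exact: local_prefix.
Qed.

Lemma subshift_of_shift_pow (k : int) x : X x -> X (shift_pow k x).
Proof.
move=> Xx n m nm; rewrite window_prefix shift_powD.
have nmk : n + k <= m + k by lia.
by have := Xx _ _ nmk; rewrite window_prefix (_ : m + k - (n + k) = m - n) //; lia.
Qed.

(** By uniform recurrence, a central window of [y] occurs in every long window of [x], so the orbit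
    of [x] comes arbitrarily close to [y]. *)
Lemma minimal_subshift_of :
  X !=set0 ->
  (forall v, L v -> exists H, forall u, L u -> (H <= size u)%N -> infix v u) ->
  minimal_subshift X.
Proof.
move=> X0 rec; split; first split=> //.
- exact: subshift_of_closed.
- apply/seteqP; split=> [_ [x Xx <-]|x Xx].
    exact: (@subshift_of_shift_pow 1).
  exists (shift_pow (-1) x); first exact: subshift_of_shift_pow.
  by rewrite shift_map_pow shift_powD subrr shift_pow0.
move=> x Xx; apply/seteqP; split.
  rewrite [X in _ `<=` X](iffLR (closure_id _) subshift_of_closed).
  by apply: closureS => _ [k _ <-]; exact: subshift_of_shift_pow.
move=> y Xy O /nbhsP_agree[r rO].
have [H HP] := rec _ ((subshift_ofP y).1 Xy r).
have LH : L (prefix_of H.+1 x).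
  by have := Xx 0 H%:Z isT; rewrite window_prefix subr0 absz_nat shift_pow0.
have := HP _ LH; rewrite size_prefix_of leqnSn => /(_ isT) /infixP[u1 [u2 E]].
(* The occurrence starts at [size u1]; adding [r] brings its centre to the origin. *)
exists (shift_pow (size u1 + r)%N%:Z x); split; first by exists (size u1 + r)%N%:Z.
apply: rO => z zr; pose i := absz (z + r%:Z).
have ir : (i < r.*2.+1)%N by rewrite /i; lia.
have : nth point (prefix_of H.+1 x) (size u1 + i) =
       nth point (prefix_of r.*2.+1 (shift_pow (- r%:Z) y)) i.
  rewrite E nth_cat ifF; last by apply/negbTE; rewrite -leqNgt leq_addr.
  by rewrite addKn nth_cat size_prefix_of ir.
have uH : (size u1 + i < H.+1)%N.
  have := congr1 size E; rewrite !size_cat !size_prefix_of; lia.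
rewrite !(nth_map 0%N) ?size_iota // !nth_iota // !add0n /shift_pow => yx.
have -> : z = i%:Z - r%:Z by rewrite /i; lia.
by rewrite -yx; congr x; rewrite /i; lia.
Qed.

End Directive.

(** * Full measure of S-adic subshifts *)

Lemma full_measure_bigcap (R : realType) d (T : measurableType d)
    (mu : probability T R) (F : (set T)^nat) (X : set T) :
  measurable X -> (forall n, measurable (F n)) -> (forall n, mu (F n) = 1%E) ->
  \bigcap_n F n `<=` X -> mu X = 1%E.
Proof.
move=> mX mF muF FX.
have nF n : mu.-negligible (~` F n).
  have muF0 : mu (~` F n) = 0%E by rewrite probability_setC // muF subee.
  by apply/negligibleP; first exact: measurableC.
have : mu.-negligible (~` X).
  apply: negligibleS (negligible_bigcup nF) => x nXx.
  by rewrite -setC_bigcap; apply: contra_not nXx; exact: FX.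
move/(negligibleP _ (measurableC mX)) => muX0.
have : mu (~` X) = 0%E by exact: muX0.
rewrite probability_setC // => /eqP.
by rewrite sube_eq ?add0e ?fin_num_measure // => /eqP.
Qed.

(** By invariance a centred window is distributed like a prefix, hence is almost surely a factor of
    some [w m]. *)
Lemma full_measure_subshift (R : realType) (A : alphabetType)
    (s : nat -> substitution A A) (w : nat -> seq A) (mu : probability (borel A) R) :
  shift_invariant mu ->
  (forall m v, infix v (w m) -> @language (fun=> A) s v) ->
  (forall l, mu [set x : fullshift A | exists m, infix (prefix_of l x) (w m)] = 1%E) ->
  mu (@subshift_of (fun=> A) s) = 1%E.
Proof.
move=> muT ws muw.
pose E l := [set x : fullshift A | exists m, infix (prefix_of l x) (w m)].
have lE l : local (E l) by exact: (local_prefix (fun v => exists m, infix v (w m))).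
pose F r := @shift_pow A (- r%:Z) @^-1` E r.*2.+1.
have lF r : local (F r) by exact: local_shift_pow.
apply: (@full_measure_bigcap R _ _ mu F).
- rewrite -[X in measurable X]setCK; apply: measurableC; apply: sub_sigma_algebra.
  exact: closed_openC (@subshift_of_closed A s).
- by move=> r; exact: measurable_local.
- move=> r; rewrite -(shift_invariant_pow muT r (measurable_local (lF r))) -(muw r.*2.+1).
  congr (mu _); apply/seteqP; split=> x;
  by rewrite /F /preimage /= shift_powD addNr shift_pow0.
- move=> x Fx; apply/subshift_ofP => r; have [m] := Fx r I; exact: ws.
Qed.

(** * The directive sequence *)

Section Morphism.
Variables (A B : alphabetType) (f : A -> seq B).

Definition subst (u : word A) : word B := flatten [seq f a | a <- u].

Fact subst_cat : {morph subst : u v / u ++ v}.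
Proof. by move=> u v; rewrite /subst map_cat flatten_cat. Qed.

HB.instance Definition _ :=
  isMultiplicative.Build (word A) (word B) subst subst_cat.
HB.instance Definition _ :=
  Multiplicative_isUMagmaMorphism.Build (word A) (word B) subst erefl.

End Morphism.

Definition letters (n : nat) : Type := 'I_n.+1.
HB.instance Definition _ n := Finite.on (letters n).
HB.instance Definition _ n := isPointed.Build (letters n) ord0.

Section Construction.
Variable n : nat.
Local Notation A := (letters n : alphabetType).

(* 0 is [G] and 1 is [D]; the values 2 and 3 only serve to have exactly four
   substitutions. *)
Definition letter_image (k : nat) (b : A) : seq A :=
  match k with
  | 0 => if ordS b == ord0 then enum 'I_n.+1 else [:: ordS b]
  | 1 => if b == ord0 then [:: ord0; ord0] else [:: b]
  | _ => nseq k.+1 b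
  end.

Definition theta k : substitution A A := subst (letter_image k).

Lemma theta_letterE k b : theta k [:: b] = letter_image k b.
Proof. exact: cats0. Qed.

(** This length tells the substitutions apart even over a single letter, where [G] is the
    identity. *)
Lemma size_theta_ord0 k : size (theta k [:: ord0]) = k.+1.
Proof.
rewrite theta_letterE; case: k => [|[|k]] //=; last by rewrite size_nseq.
by case: eqP => //= /(congr1 val) /=; rewrite size_enum_ord; case: (n).
Qed.

Lemma theta_inj : injective theta.
Proof.
move=> k l kl; apply: succn_inj.
by rewrite -(size_theta_ord0 k) kl size_theta_ord0.
Qed.

Lemma theta_letter k a : (k <= 1)%N -> exists b, a \in theta k [:: b].
Proof.
case: k => [|[|//]] _; last first.
  by exists a; rewrite theta_letterE /=; case: eqP => [->|_]; rewrite !inE eqxx.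
exists (ord_pred a); rewrite theta_letterE /= ord_predK.
by case: ifP => _; rewrite ?mem_enum ?inE.
Qed.

Lemma theta1_fixed k (u : seq A) : ord0 \notin u -> iter k (theta 1) u = u.
Proof.
move=> u0; elim: k => //= k ->; elim: u u0 => //= b u IH.
rewrite in_cons negb_or eq_sym => /andP[b0 /IH uE].
by rewrite /theta /= /subst /= (negbTE b0) /=; congr cons.
Qed.

Lemma theta1_cat k (u v : seq A) :
  iter k (theta 1) (u ++ v) = iter k (theta 1) u ++ iter k (theta 1) v.
Proof. by elim: k => [//|k IH]; rewrite !iterS IH substitution_cat. Qed.

Lemma theta1_nseq k : iter k (theta 1) [:: ord0] = nseq (2 ^ k) ord0.
Proof.
elim: k => [//|k IHk]; rewrite iterS IHk expnS; elim: (2 ^ k)%N => [//|m IH].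
by rewrite mulnS -[nseq m.+1 _]cat1s substitution_cat IH.
Qed.

Definition apply_word (p : seq nat) (u : seq A) : seq A :=
  foldr (fun k v => theta k v) u p.

(* 2 ^ exponent exceeds 2 ^ (j + 3) times the total length of the images of the
   letters under the composition coded by [p]. *)
Definition exponent (p : seq nat) (j : nat) : nat :=
  ((\sum_(b : 'I_n.+1) size (apply_word p [:: b])) + j.+3)%N.

(** As [exponent] depends on the substitutions already chosen, the sequence is built through finite
    prefixes, each adding one block [D^k G]. *)
Fixpoint blocks (j : nat) : seq nat :=
  if j is i.+1 then blocks i ++ rcons (nseq (exponent (blocks i) i) 1%N) 0%N
  else [::].

(** [blocks k.+1] has more than [k] entries, so the default value is never read. *)
Definition code (k : nat) : nat := nth 0%N (blocks k.+1) k.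

Definition directive (k : nat) : substitution A A := theta (code k).

Lemma leq_size_blocks j : (j <= size (blocks j))%N.
Proof.
elim: j => //= j IH; rewrite size_cat size_rcons addnS ltnS.
exact: leq_trans (leq_addr _ _).
Qed.

Lemma blocks_prefix i j : (i <= j)%N -> exists q, blocks j = blocks i ++ q.
Proof.
elim: j => [|j IH]; first by rewrite leqn0 => /eqP ->; exists [::].
rewrite leq_eqVlt => /predU1P[->|]; first by exists [::]; rewrite cats0.
by rewrite ltnS => /IH[q E]; rewrite /= E -catA; eexists.
Qed.

Lemma nth_blocks j k : (k < size (blocks j))%N -> nth 0%N (blocks j) k = code k.
Proof.
move=> kj; rewrite /code; have kk := leq_size_blocks k.+1.
have [/blocks_prefix[q E]|/ltnW/blocks_prefix[q E]] := leqP k.+1 j.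
  by rewrite E nth_cat kk.
by rewrite E nth_cat kj.
Qed.

Lemma blocks_code j : blocks j = mkseq code (size (blocks j)).
Proof.
apply: (@eq_from_nth _ 0%N) => [|k kj]; first by rewrite size_mkseq.
by rewrite nth_mkseq // nth_blocks.
Qed.

Lemma code_le1 k : (code k <= 1)%N.
Proof.
have blocks_le1 j : all (fun c => c <= 1)%N (blocks j).
  elim: j => //= j IH; rewrite all_cat IH all_rcons /=.
  by apply/allP => x /nseqP[->].
by apply: (allP (blocks_le1 k.+1)); rewrite mem_nth // leq_size_blocks.
Qed.

Local Notation img := (img directive).

Lemma img_code m u : img m u = apply_word (mkseq code m) u.
Proof.
elim: m u => [//|m IH] u.
by rewrite mkseqS /apply_word foldr_rcons -/(apply_word _ _) -IH.
Qed.

Lemma img_blocks j u : img (size (blocks j)) u = apply_word (blocks j) u.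
Proof. by rewrite img_code -blocks_code. Qed.

(** * Images of letters after complete blocks *)

Definition stage (j : nat) (b : A) : seq A := img (size (blocks j)) [:: b].

Lemma stageS j b : stage j.+1 b = img (size (blocks j))
  (iter (exponent (blocks j) j) (theta 1) (theta 0 [:: b])).
Proof.
rewrite /stage !img_blocks /= /apply_word foldr_cat foldr_rcons; congr foldr.
by elim: (exponent _ _) => //= k ->.
Qed.

(* The label under which the images descending from the letter [i] appear
   after [j] blocks. *)
Definition pos (i : A) (j : nat) : A := iter j (@ord_pred n.+1) i.

(** The words [w_n(i)] to which the rank-one construction applies, with one step per block. *)
Definition tower (i : A) (j : nat) : seq A := stage j (pos i j).

Definition rest : seq A := [seq lift ord0 k | k <- enum 'I_n].

Definition reps (i : A) (j : nat) : nat :=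
  (if pos i j == ord0 then 2 ^ exponent (blocks j) j else 1)%N.

Definition tail (i : A) (j : nat) : seq A :=
  if pos i j == ord0 then img (size (blocks j)) rest else [::].

Lemma ord0_rest : (ord0 : A) \notin rest.
Proof. by apply/mapP => -[k _ /(congr1 val)]. Qed.

(** [G] sends the new label to the old one, which [D] fixes, unless the old label is 0; then it
    gives [0 1 ... d-1], of which the powers of [D] expand only the 0. *)
Lemma towerS i j : tower i j.+1 = flatten (nseq (reps i j) (tower i j)) ++ tail i j.
Proof.
rewrite /tower stageS theta_letterE /= ord_predK /reps /tail.
case: ifP => [/eqP ->|/negbT pos0]; last first.
  by rewrite theta1_fixed ?inE 1?eq_sym //= !cats0.
rewrite enum_ordSl -/rest -cat1s theta1_cat theta1_nseq.
rewrite theta1_fixed ?ord0_rest // img_cat; congr (_ ++ _).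
by rewrite img_flatten map_nseq.
Qed.

Lemma iter_ord_pred (b : 'I_n.+1) k : (k <= b)%N ->
  iter k (@ord_pred n.+1) b = (b - k)%N :> nat.
Proof.
elim: k => [|k IH] kb; first by rewrite subn0.
rewrite /= IH; last exact: ltnW.
have -> : ((b - k + n.+1).-1 = b - k.+1 + n.+1)%N by lia.
by rewrite modnDr modn_small //; have := ltn_ord b; lia.
Qed.

Lemma pos_ord0 i j : pos i (j + pos i j) = ord0.
Proof.
rewrite /pos addnC iterD; apply: val_inj => /=.
by rewrite iter_ord_pred // subnn.
Qed.

Lemma size_img m u : size (img m u) = (\sum_(b <- u) size (img m [:: b]))%N.
Proof. by rewrite img_flatten size_flatten /shape -map_comp sumnE big_map. Qed.

Lemma exponentE j :
  exponent (blocks j) j = (\sum_(b : 'I_n.+1) size (stage j b) + j.+3)%N.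
Proof.
by rewrite /exponent; congr (_ + _)%N; apply: eq_bigr => b _; rewrite -img_blocks.
Qed.

Lemma pos_surj j b : exists i, pos i j = b.
Proof.
exists (iter j (@ordS n.+1) b); rewrite /pos; elim: j => [//|j IH].
by rewrite iterSr iterS ordSK.
Qed.

Lemma reps_gt0 i j : (0 < reps i j)%N.
Proof. by rewrite /reps; case: eqP => // _; rewrite expn_gt0. Qed.

Lemma size_stage j b : (0 < size (stage j b))%N.
Proof.
have [i <-] := pos_surj j b; rewrite -[stage _ _]/(tower i j).
elim: j => [//|j IH]; rewrite towerS size_cat ltn_addr //.
by rewrite size_flatten_nseq muln_gt0 reps_gt0.
Qed.

Lemma tail_small i j : (size (tail i j) * 2 ^ j.+3 <= reps i j * size (tower i j))%N.
Proof.
rewrite /tail /reps /tower; case: eqP => [->|_]; last by rewrite mul0n.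
pose T := (\sum_(k < n) size (stage j (lift ord0 k)))%N; pose S := size (stage j ord0).
have TE : size (img (size (blocks j)) rest) = T.
  by rewrite size_img /rest big_map big_enum.
have SE : (\sum_(b : 'I_n.+1) size (stage j b) = S + T)%N by rewrite big_ord_recl.
have S0 : (0 < S)%N by exact: size_stage.
rewrite exponentE expnD SE TE mulnAC leq_mul2r; apply/orP; right.
(* After cancelling [2 ^ j.+3], it suffices that [T <= 2 ^ (S + T)], since [S] is positive. *)
have := ltn_expl (S + T) (isT : (1 < 2)%N); rewrite -/S; nia.
Qed.

Lemma reps_large i k : exists2 m, (k <= m)%N & (2 ^ m.+3 <= reps i m)%N.
Proof.
exists (k + pos i k)%N; first exact: leq_addr.
by rewrite /reps pos_ord0 eqxx exponentE leq_exp2l // leq_addl.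
Qed.

Lemma tower0 i : tower i 0 = [:: i].
Proof. by []. Qed.

(** * Recurrence of the language *)

Lemma img_mem m a u : a \in u -> infix (img m [:: a]) (img m u).
Proof.
case/splitPr => u1 u2; rewrite -[a :: u2]cat1s !img_cat; apply/infixP.
by exists (img m u1), (img m u2).
Qed.

Lemma img_infix m m' a : (m <= m')%N ->
  exists b, infix (img m [:: a]) (img m' [:: b]).
Proof.
elim: m' => [|m' IH].
  by rewrite leqn0 => /eqP ->; exists a; exact: infix_refl.
rewrite leq_eqVlt => /predU1P[->|]; first by exists a; exact: infix_refl.
rewrite ltnS => /IH[b ab]; have [c bc] := theta_letter b (code_le1 m').
by exists c; apply: infix_trans ab _; exact: img_mem.
Qed.

(** The language is defined from at least one substitution, so [img m] is first embedded in the next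
    level; this covers [m = 0]. *)
Lemma img_language m a v : infix v (img m [:: a]) -> @language (fun=> A) directive v.
Proof.
move=> va; have [b ab] := img_infix a (leqnSn m).
by exists m, b; rewrite comp_upto_img; exact: infix_trans ab.
Qed.

Lemma tower_infix i j j' : (j <= j')%N -> infix (tower i j) (tower i j').
Proof.
elim: j' => [|j' IH]; first by rewrite leqn0 => /eqP ->; exact: infix_refl.
rewrite leq_eqVlt => /predU1P[->|]; first exact: infix_refl.
rewrite ltnS => /IH /infix_trans; apply; rewrite towerS.
have := reps_gt0 i j'; case: (reps i j') => // k _ /=; rewrite -catA.
by apply/infixP; exists [::]; eexists.
Qed.

(** At its turn, a tower takes in the image of 0 through its power and those of the other letters
    through its tail. *)
Lemma stage_infix_tower i j c : pos i j = ord0 -> infix (stage j c) (tower i j.+1).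
Proof.
move=> p0; rewrite towerS; have := reps_gt0 i j; rewrite /tail p0 eqxx.
case: (reps i j) => // k _ /=; rewrite /tower p0 -catA.
have [->|c0] := eqVneq c ord0; first by apply/infixP; exists [::]; eexists.
have : c \in rest.
  case: (unliftP ord0 c) c0 => [l -> _|->]; last by rewrite eqxx.
  by apply: map_f; rewrite mem_enum.
move=> /(@img_mem (size (blocks j)))/infixP[x [y ->]].
apply/infixP; exists (stage j ord0 ++ flatten (nseq k (stage j ord0)) ++ x), y.
by rewrite -/(stage j c) -!catA.
Qed.

Lemma stage_infix j b c : infix (stage j c) (stage (j + n.+1) b).
Proof.
have [i <-] := pos_surj (j + n.+1) b; have [k <-] := pos_surj j c.
rewrite -![stage _ (pos _ _)]/(tower _ _).
(* The turn of [i] comes at block [j + pos i j]. The tower of [k] persists until then, is absorbed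
   by that of [i], and the latter persists in turn. *)
have jm : (j <= j + pos i j)%N by exact: leq_addr.
apply: infix_trans (tower_infix k jm) _.
apply: infix_trans (stage_infix_tower _ (pos_ord0 i j)) _.
by apply: tower_infix; have := ltn_ord (pos i j); lia.
Qed.

Lemma img_add m r u : exists v, img (m + r) u = img m v.
Proof.
elim: r u => [|r IH] u; first by exists u; rewrite addn0.
by rewrite addnS /=; exact: IH.
Qed.

(** At some fixed level [v] occurs in the images of all letters, and a long word of the language
    contains one of these images in full. *)
Lemma directive_recurrent v : @language (fun=> A) directive v ->
  exists H, forall u, @language (fun=> A) directive u -> (H <= size u)%N -> infix v u.
Proof.
move=> [m [a]]; rewrite comp_upto_img => va.
have [b ab] := img_infix a (leq_size_blocks m.+1).
pose J := (m.+1 + n.+1)%N; pose M := size (blocks J).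
(* Level [M] bounds the pieces; the lower levels are included so that a word longer than [2 * B]
   cannot come from them. *)
pose B := (\max_(k < M.+1) \max_(c : 'I_n.+1) size (img k [:: c]))%N.
have BP k c : (k <= M)%N -> (size (img k [:: c]) <= B)%N.
  rewrite -ltnS => kM; apply: leq_trans (@leq_bigmax _ _ (Ordinal kM)).
  exact: (@leq_bigmax _ (fun c : 'I_n.+1 => size (img k [:: c])) c).
exists (2 * B).+1 => u [k [c]]; rewrite comp_upto_img => uc Bu.
have [kM|Mk] := leqP k.+1 M.
  by have := leq_trans Bu (leq_trans (size_infix uc) (BP _ c kM)); lia.
have [z zE] := img_add M (k.+1 - M) [:: c].
move: uc; rewrite -(subnKC (ltnW Mk)) zE img_flatten => uz.
have [|w /mapP[d _ ->] wu] := @infix_flatten _ B _ u _ Bu uz.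
  by move=> w /mapP[d _ ->]; exact: BP.
apply: infix_trans wu; apply: infix_trans va _; apply: infix_trans ab _.
exact: stage_infix.
Qed.

Local Notation X := (@subshift_of (fun=> A) directive).

Lemma directive_ergodic_measures (R : realType) : supports_ergodic_measures R X n.+1.
Proof.
have /choice[mu muP] : forall i : 'I_n.+1, exists mu : probability (borel A) R,
    [/\ mu X = 1%E, shift_invariant mu, ergodic mu &
        ((3 / 4)%:E <= mu [set x : fullshift A | x 0%R = i])%E].
  move=> i; have [|||||mu [muT mu_erg mu_fac mu_let]] :=
    @rank_one_measure R A (tower i) (reps i) (tail i).
  - by rewrite tower0.
  - exact: towerS.
  - exact: reps_gt0.
  - exact: tail_small.
  - exact: reps_large.
  exists mu; split=> //; last by apply: mu_let; exact: tower0.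
  by apply: full_measure_subshift mu_fac => // m v; exact: img_language.
exists mu; split=> [i|i j ij]; first by case: (muP i).
have mE (k : 'I_n.+1) : measurable ([set x : fullshift A | x 0%R = k] : set (borel A)).
  by apply: measurable_local; exists 0%N => x y xy /= <-; rewrite xy.
(* Otherwise two disjoint events would both have mass at least 3/4 under [mu j]. *)
exists [set x : fullshift A | x 0%R = i] => // muij.
have [_ _ _ mi] := muP i.
have [_ _ _ mj] := muP j.
rewrite muij in mi.
have := probability_le1 (mu j) (measurableU _ _ (mE i) (mE j)).
rewrite measureU //; last first.
  by apply/seteqP; split=> // x [/= -> /eqP]; rewrite (negbTE ij).
apply/negP; rewrite -ltNge; apply: lt_le_trans (_ : ((3 / 4)%:E + (3 / 4)%:E <= _)%E).
  by rewrite -EFinD lte_fin; lra.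
exact: leeD.
Qed.

(** Non-emptiness comes from the measures, since the empty set cannot have mass 1; hence the
    parameter [R]. *)
Lemma directive_minimal (R : realType) : minimal_subshift X.
Proof.
apply: minimal_subshift_of; last exact: directive_recurrent.
have [mu [/(_ ord0)[muX _ _] _]] := directive_ergodic_measures R.
apply/set0P/eqP => X0; move: muX; rewrite X0 measure0 => /eqP.
by rewrite eq_sym onee_eq0.
Qed.

End Construction.

Theorem proposition1p1 (R : realType) :
  (forall d : nat, (1 <= d)%N ->
    exists (A : nat -> alphabetType)
           (s : forall n, substitution (A n.+1) (A n)),
      [/\ forall n, #|A n| = d,
          minimal_subshift (subshift_of s)
        & supports_ergodic_measures R (subshift_of s) d])
  /\
  (forall d : nat, (1 <= d)%N ->
    exists (A : alphabetType) (S : set (substitution A A)),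
      [/\ #|A| = d,
          (S #= `I_4)%card
        & exists s : nat -> substitution A A,
            [/\ forall n, S (s n),
                minimal_subshift (@subshift_of (fun=> A) s)
              & supports_ergodic_measures R (@subshift_of (fun=> A) s) d]]).
Proof.
have main d : (1 <= d)%N -> exists (A : alphabetType) (S : set (substitution A A)),
  [/\ #|A| = d, (S #= `I_4)%card & exists s : nat -> substitution A A,
    [/\ forall n, S (s n), minimal_subshift (@subshift_of (fun=> A) s)
      & supports_ergodic_measures R (@subshift_of (fun=> A) s) d]].
  case: d => // n _; exists (letters n), (@theta n @` `I_4); split.
  - exact: card_ord.
  - by apply: inj_card_eq => k l _ _; exact: theta_inj.
  - exists (directive n); split.
    + by move=> k; exists (code n k) => //=; apply: leq_ltn_trans (code_le1 n k) _.
    + exact: (directive_minimal n R).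
    + exact: directive_ergodic_measures.
split=> d d1; last exact: main.
have [A [S [Ad _ [s [_ smin serg]]]]] := main d d1.
by exists (fun=> A), s.
Qed.
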